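(* Let $q\in[0,1]$ and let $R_q>0$, $\omega>0$ be such that $\Theta^*\in\mathbb{B}_q(R_q)\cap\mathbb{S}$. Let $\hat\Theta$ be a global optimum of $$\min_{\Theta\in\mathbb{S}}\left\{\tfrac12\langle\hat\Gamma\Theta,\Theta\rangle-\langle\hat\Upsilon,\Theta\rangle+\lambda\|\Theta\|_*\right\}.$$ Suppose that the deviation condition $$\|\hat\Upsilon-\hat\Gamma\Theta^*\|_{\mathrm{op}}\le\varphi\sqrt{\frac{\max(d_1,d_2)}{n}}$$ holds, and that $\hat\Gamma$ satisfies the restricted strong convexity condition $$\langle\hat\Gamma\Delta,\Delta\rangle\ge\alpha_1\|\Delta\|_F^2-\tau\|\Delta\|_*^2\quad\text{for all }\Delta\in\mathbb{R}^{d_1\times d_2}$$ with some $\alpha_1>0$ and some $\tau>0$ satisfying $$\tau\le\frac{\varphi}{\omega}\sqrt{\frac{\max(d_1,d_2)}{n}}.$$ Assume that $\lambda$ satisfies $$\lambda\ge2\varphi\sqrt{\frac{\max(d_1,d_2)}{n}}.$$ Then $$\|\hat\Theta-\Theta^*\|_F^2\le544\,R_q\left(\frac{\lambda}{\alpha_1}\right)^{2-q}\qquad\text{and}\qquad\|\hat\Theta-\Theta^*\|_*\le(4+32\sqrt{17})\,R_q\left(\frac{\lambda}{\alpha_1}\right)^{1-q}.$$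
   Context: Let $d_1,d_2,n$ be positive integers and $d=\min\{d_1,d_2\}$. For $\Theta\in\mathbb{R}^{d_1\times d_2}$ let $\sigma_1(\Theta)\ge\dots\ge\sigma_d(\Theta)\ge0$ be its singular values; $\|\Theta\|_*=\sum_j\sigma_j(\Theta)$ is the nuclear norm, $\|\Theta\|_{\mathrm{op}}=\sigma_1(\Theta)$ the operator norm, $\|\Theta\|_F$ the Frobenius norm, and $\langle\Theta,\Gamma\rangle=\mathrm{trace}(\Theta^\top\Gamma)$. For $q\in[0,1]$, $R_q>0$, the matrix $\ell_q$-ball is $\mathbb{B}_q(R_q)=\{\Theta\in\mathbb{R}^{d_1\times d_2}:\sum_{i=1}^d|\sigma_i(\Theta)|^q\le R_q\}$ (with $0^0=0$, so that for $q=0$ it is the set of matrices of rank at most $R_0$). For $\omega>0$, $\mathbb{S}=\{\Theta\in\mathbb{R}^{d_1\times d_2}:\|\Theta\|_*\le\omega\}$. $\Theta^*\in\mathbb{R}^{d_1\times d_2}$ is a fixed (true) parameter matrix; $\hat\Gamma\in\mathbb{R}^{d_1\times d_1}$ (symmetric) and $\hat\Upsilon\in\mathbb{R}^{d_1\times d_2}$ are given surrogate matrices; $\varphi>0$ is a real number (written $\phi(\mathbb{Q},\sigma_\epsilon)$ in the paper) and $\lambda>0$ is the regularization parameter. The statement is deterministic. *)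

(* Defs.v *)
From HB Require Import structures.
From mathcomp Require Import all_boot all_order all_algebra.
From mathcomp Require Import polyrcf.
From mathcomp Require Import classical_sets reals exp.

Set Implicit Arguments.
Unset Strict Implicit.
Unset Printing Implicit Defensive.

Import Order.TTheory GRing.Theory Num.Theory.

Local Open Scope classical_set_scope.
Local Open Scope ring_scope.

(* The real eigenvalues of a square matrix, each repeated according to its
   multiplicity as a root of the characteristic polynomial. *)
Definition eigenvalues (R : realType) (n : nat) (M : 'M[R]_n) : seq R :=
  flatten [seq nseq (mup x (char_poly M)) x | x <- rootsR (char_poly M)].

(* A^T A has n eigenvalues, of which the n - min(m, n) smallest vanish; they
   are dropped, leaving the min(m, n) singular values. *)
Definition singular_values (R : realType) (m n : nat) (A : 'M[R]_(m, n)) :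
    seq R :=
  take (minn m n)
    (sort >=%R [seq Num.sqrt x | x <- eigenvalues (A^T *m A)]).

(* Singular values are indexed from 0: sigma A 0 is the largest one. *)
Definition sigma (R : realType) (m n : nat) (A : 'M[R]_(m, n)) (i : nat) : R :=
  (singular_values A)`_i.

Definition nuclear_norm (R : realType) (m n : nat) (A : 'M[R]_(m, n)) : R :=
  \sum_(i < minn m n) sigma A i.

Definition op_norm (R : realType) (m n : nat) (A : 'M[R]_(m, n)) : R :=
  sigma A 0.

Definition frobenius_norm (R : realType) (m n : nat) (A : 'M[R]_(m, n)) : R :=
  Num.sqrt (\sum_i \sum_j A i j ^+ 2).

Definition mx_inner (R : realType) (m n : nat) (A B : 'M[R]_(m, n)) : R :=
  \tr (A^T *m B).

(* Real power with the convention 0^0 = 0, whereas 0 `^ 0 = 1. *)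
Definition powR00 (R : realType) (x q : R) : R :=
  if x == 0 then 0 else x `^ q.

Definition lq_ball (R : realType) (m n : nat) (q Rq : R) :
    set 'M[R]_(m, n) :=
  [set A | \sum_(i < minn m n) powR00 `|sigma A i| q <= Rq].

Definition nuclear_ball (R : realType) (m n : nat) (omega : R) :
    set 'M[R]_(m, n) :=
  [set A | nuclear_norm A <= omega].

Definition objective (R : realType) (m n : nat)
    (Gamma : 'M[R]_m) (Upsilon : 'M[R]_(m, n)) (lambda : R)
    (Theta : 'M[R]_(m, n)) : R :=
  2^-1 * mx_inner (Gamma *m Theta) Theta - mx_inner Upsilon Theta
  + lambda * nuclear_norm Theta.

Definition global_minimizer (R : realType) (T : Type) (S : set T) (f : T -> R)
    (x : T) : Prop :=
  S x /\ (forall y, S y -> f x <= f y).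

(* Main.v *)
Require Import Defs.
From HB Require Import structures.
From mathcomp Require Import all_boot all_order all_algebra.
From mathcomp Require Import complex polyrcf.
From mathcomp Require Import classical_sets reals exp.
From mathcomp Require Import ring lra.

(** Write [Delta] for the error and [N] for its nuclear norm. Comparing the
    objective at the optimum and at the true parameter, and then applying
    restricted strong convexity and the deviation bound through the duality of
    the operator and nuclear norms, gives

      alpha1 |Delta|_F^2 <= tau N^2 + 2 c N + 2 lambda (a - b),

    where [c] is the deviation level and [a], [b] are the nuclear norms of the
    true parameter and of the estimate. Let [rho = lambda / alpha1] and let [U]
    be the sum of the [u_j v_j^T] over the singular pairs of the true parameter
    with singular value above [rho]. With [P = U U^T] and [Q = U^T U], the
    residual [(1 - P) Delta (1 - Q)], of nuclear norm [N''], is invisible to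
    the large singular pairs, and the remaining part of [Delta], of nuclear
    norm [N'], has low rank. Two facts follow, [t] being the sum of the small
    singular values and [r] the number of large ones:

      b >= a - 2 t - N' + N''        ([nuclear_norm_decomposable]),
      N'^2 <= 2 r |Delta|_F^2        ([nuclear_norm_nonresidual]).

    Since [N <= 2 omega], the quadratic term is at most [lambda N], so the
    terms in [N''] cancel and [|Delta|_F^2 <= 4 rho (N' + t)]. The l_q
    condition bounds [r rho^q] and [t / rho^(1 - q)] by [Rq]
    ([lq_threshold]), and the Frobenius bound follows, with constant 40.

    For the nuclear bound, [N''] has to be controlled by [N'] and [t]. Bounding
    [N] by [2 omega] is too lossy here: it only gives [b - a <= N]. But
    [N <= a + b <= 2 omega - (b - a)], so if [N] is close to [2 omega] then
    [b - a] is small, and if it is not, the quadratic term is smaller than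
    [lambda N] by a constant factor. In both cases [b - a <= (4/5) N]
    ([norm_gap_bound]), which puts [Delta] in the cone
    [N'' <= 9 N' + 10 t].

    On the matrix side everything rests on one description of the nuclear norm:
    it is the maximum of the inner product with [A] over all contractions
    ([nuclear_norm_ge_inner], [nuclear_norm_attained]). The triangle
    inequality and decomposability come from testing with a well chosen
    contraction, so only right singular vectors of [A] are needed: an orthogonal
    [V] diagonalising [A^T A], for which the columns of [A V] are orthogonal
    with norms the singular values. *)

Set Implicit Arguments.
Unset Strict Implicit.
Unset Printing Implicit Defensive.

Import Order.TTheory GRing.Theory Num.Theory.
Local Open Scope ring_scope.

(** * The spectral theorem for real symmetric matrices *)

(** Over the complex numbers [M] is Hermitian, hence unitarily diagonalisable
    with real eigenvalues; a real eigenvalue of the complexified matrix is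
    already an eigenvalue of [M]. *)
Lemma symmetric_eigenvalue_exists (R : rcfType) n (M : 'M[R]_n.+1) :
  M^T = M -> exists a, eigenvalue M a.
Proof.
move=> Msym.
pose c := real_complex R.
pose MC := map_mx c M.
have cJ x : Num.conj (c x) = c x.
  by rewrite /c; apply/eqP; rewrite eq_complex /= oppr0 !eqxx.
have MCherm : MC \is hermsymmx.
  apply/is_hermitianmxP; rewrite expr0 scale1r; apply/matrixP => i j.
  by rewrite !mxE cJ -[in RHS]Msym mxE.
have /orthomx_spectralP MCE := hermitian_normalmx MCherm.
have /mxOverP /(_ 0 0) dreal := hermitian_spectral_diag_real MCherm.
set d := spectral_diag MC in MCE dreal.
set P := spectralmx MC in MCE.
have [a dE] : exists a, d 0 0 = c a.
  exists (complex.Re (d 0 0)); move/CrealP: dreal; case: (d 0 0) => x y.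
  move/eqP; rewrite eq_complex /= => /andP[_ /eqP y0].
  by congr (_ +i* _)%C; lra.
exists a; rewrite -(eigenvalue_map c).
apply/eigenvalueP; exists (row 0 P); last first.
  apply/negP => /eqP P0; have /row_freeP[Q] : row_free P.
    by rewrite row_free_unit spectral_unit.
  move/(congr1 (row 0)); rewrite row_mul P0 mul0mx => /matrixP /(_ 0 0).
  by rewrite !mxE /= => /eqP; rewrite eq_sym oner_eq0.
rewrite -/MC MCE -row_mul !mulmxA mulmxV ?spectral_unit// mul1mx.
by rewrite row_mul row_diag_mx -scalemxAl -rowE dE.
Qed.

Lemma row_sqr_eq0 (R : realDomainType) n (v : 'rV[R]_n) :
  \sum_i v 0 i ^+ 2 = 0 -> v = 0.
Proof.
move/eqP; rewrite psumr_eq0 => [/allP v0|i _]; last exact: sqr_ge0.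
apply/rowP => j; rewrite mxE; apply/eqP; rewrite -sqrf_eq0.
by apply: (v0 j); rewrite mem_index_enum.
Qed.

(** The reflection in the hyperplane orthogonal to [v - e], with [e] the first
    basis vector, exchanges [e] and [v]. When [v = e] the convention
    [0^-1 = 0] turns the same formula into the identity. *)
Lemma householder_reflection (R : realFieldType) n (v : 'rV[R]_n.+1) :
  v *m v^T = 1%:M ->
  exists H : 'M_n.+1, [/\ H^T = H, H *m H = 1%:M & delta_mx 0 0 *m H = v].
Proof.
move=> v1; pose e := delta_mx 0 0 : 'rV[R]_n.+1; pose w := v - e.
pose z := (e *m v^T) 0 0; pose g := 2 - 2 * z.
have evT : e *m v^T = z%:M by rewrite [LHS]mx11_scalar.
have veT : v *m e^T = z%:M.
  by rewrite -[LHS]trmxK trmx_mul trmxK evT tr_scalar_mx.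
have eeT : e *m e^T = 1%:M.
  rewrite /e trmx_delta mul_delta_mx; apply/matrixP => i j.
  by rewrite !ord1 !mxE.
have ewT : e *m w^T = (z - 1)%:M by rewrite linearB /= mulmxBr evT eeT raddfB.
have wwT : w *m w^T = g%:M.
  rewrite mulmxBl ewT linearB /= mulmxBr v1 veT -!raddfB; congr (_%:M).
  by rewrite /g; ring.
have g0 : g = 0 -> w = 0.
  move=> g0; apply: row_sqr_eq0.
  transitivity ((w *m w^T) 0 0); last by rewrite wwT g0 mxE mul0rn.
  by rewrite [RHS]mxE; apply: eq_bigr => i _; rewrite [w^T _ _]mxE expr2.
exists (1%:M - (2 / g) *: (w^T *m w)); split.
- by rewrite linearB linearZ /= trmx1 trmx_mul trmxK.
- have [/g0 ->|gN0] := eqVneq g 0; first by rewrite mulmx0 scaler0 subr0 mulmx1.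
  have : (w^T *m w) *m (w^T *m w) = g *: (w^T *m w).
    by rewrite mulmxA -(mulmxA w^T) wwT mul_mx_scalar -scalemxAl.
  move: (w^T *m w) => X XX.
  rewrite mulmxBl !mulmxBr !mul1mx mulmx1 -scalemxAl -scalemxAr XX !scalerA.
  rewrite opprB addrA -!scaleNr -!addrA -!scalerDl -[RHS]addr0; congr (_ + _).
  by rewrite [X in X *: _](_ : _ = 0) ?scale0r//; field.
- rewrite mulmxBr mulmx1 -scalemxAr mulmxA ewT mul_scalar_mx scalerA.
  have [/g0 w0|gN0] := eqVneq g 0.
    by rewrite w0 scaler0 subr0; apply/eqP; rewrite eq_sym -subr_eq0 -/w w0.
  have -> : 2 / g * (z - 1) = -1.
    by apply: (mulIf gN0); rewrite mulrAC divfK// /g; ring.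
  by rewrite scaleN1r opprK /w addrC subrK.
Qed.

(** Induction on the size: a reflection carries the first basis vector to a
    unit eigenvector, and in the reflected basis symmetry forces the matrix to
    be block diagonal with a smaller symmetric block. *)
Theorem symmetric_spectral (R : rcfType) n (M : 'M[R]_n) :
  M^T = M ->
  exists (V : 'M_n) (d : 'rV_n), V^T *m V = 1%:M /\ M = V *m diag_mx d *m V^T.
Proof.
elim: n M => [M _|n IHn M Msym].
  by exists 1%:M, 0; split; rewrite ?trmx1 ?mulmx1// [LHS]flatmx0 [RHS]flatmx0.
have [a /eigenvalueP[v0 v0M v0N0]] := symmetric_eigenvalue_exists Msym.
pose l := \sum_i v0 0 i ^+ 2.
have lgt0 : 0 < l.
  rewrite lt_def sumr_ge0 ?andbT => [|i _]; last exact: sqr_ge0.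
  by apply: contraNneq v0N0 => l0; apply/eqP/row_sqr_eq0.
have v0v0T : v0 *m v0^T = l%:M.
  rewrite [LHS]mx11_scalar mxE; congr (_%:M).
  by apply: eq_bigr => i _; rewrite mxE expr2.
pose v := (Num.sqrt l)^-1 *: v0.
have v1 : v *m v^T = 1%:M.
  rewrite linearZ /= -scalemxAl -scalemxAr v0v0T scalerA -invfM -expr2.
  rewrite sqr_sqrtr ?ltW//.
  by rewrite scale_scalar_mx mulVf ?gt_eqF.
have vM : v *m M = a *: v by rewrite -scalemxAl v0M scalerA mulrC -scalerA.
have [H [HT HH eH]] := householder_reflection v1.
pose e := delta_mx 0 0 : 'rV[R]_n.+1.
have vH : v *m H = e by rewrite -eH -mulmxA HH mulmx1.
have [N defN] : exists N : 'M[R]_(1 + n), N = H *m M *m H by eexists.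
have NT : N^T = N by rewrite defN !trmx_mul HT Msym mulmxA.
have eN : e *m N = a *: e by rewrite defN !mulmxA eH vM -scalemxAl vH.
have row0N j : N 0 j = a * (0 == j)%:R.
  have /matrixP /(_ 0 j) := eN; rewrite -rowE !mxE eq_sym => ->.
  by rewrite eqxx.
have NE : N = block_mx a%:M 0 0 (drsubmx N).
  rewrite -[LHS]submxK; congr block_mx.
  - by rewrite [LHS]mx11_scalar !mxE lshift0 row0N eqxx mulr1.
  - by apply/matrixP => i j; rewrite !mxE ord1 lshift0 row0N /= mulr0.
  - apply/matrixP => i j; rewrite !mxE ord1 lshift0 -NT mxE row0N /=.
    by rewrite mulr0.
have [|V [d [VV dE]]] := IHn (drsubmx N).
  by rewrite -[RHS]/(drsubmx _) -{2}NT trmx_drsub.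
pose K : 'M[R]_(1 + n) := block_mx 1%:M 0 0 V.
have KK : K^T *m K = 1%:M.
  rewrite /K tr_block_mx !trmx0 trmx1 mulmx_block !mulmx0 !mul0mx mulmx1 VV.
  by rewrite !addr0 add0r -scalar_mx_block.
have NK : N = K *m diag_mx (row_mx a%:M d) *m K^T.
  rewrite NE diag_mx_row /K tr_block_mx !trmx0 trmx1 !mulmx_block.
  rewrite !mulmx0 !mul0mx ?mulmx1 ?mul1mx !addr0 !add0r !mul0mx -dE.
  by congr block_mx; apply/matrixP => i j; rewrite !ord1 !mxE eqxx.
exists (H *m K), (row_mx a%:M d); split.
  by rewrite trmx_mul HT mulmxA -(mulmxA K^T) HH mulmx1.
have -> : M = H *m N *m H by rewrite defN !mulmxA HH mul1mx -mulmxA HH mulmx1.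
by rewrite trmx_mul HT NK !mulmxA.
Qed.

(** * The trace inner product *)

Section InnerProduct.
Variable R : realType.

Lemma mx_innerE m n (A B : 'M[R]_(m, n)) :
  mx_inner A B = \sum_j \sum_i A i j * B i j.
Proof.
by apply: eq_bigr => j _; rewrite mxE; apply: eq_bigr => i _; rewrite mxE.
Qed.

Lemma mx_innerC m n (A B : 'M[R]_(m, n)) : mx_inner A B = mx_inner B A.
Proof. by rewrite /mx_inner -mxtrace_tr trmx_mul trmxK. Qed.

Lemma mx_innerDr m n (A B C : 'M[R]_(m, n)) :
  mx_inner A (B + C) = mx_inner A B + mx_inner A C.
Proof. by rewrite /mx_inner mulmxDr raddfD. Qed.

Lemma mx_innerZr m n a (A B : 'M[R]_(m, n)) :
  mx_inner A (a *: B) = a * mx_inner A B.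
Proof. by rewrite /mx_inner -scalemxAr linearZ. Qed.

Lemma mx_innerNr m n (A B : 'M[R]_(m, n)) : mx_inner A (- B) = - mx_inner A B.
Proof. by rewrite -scaleN1r mx_innerZr mulN1r. Qed.

Lemma mx_innerBr m n (A B C : 'M[R]_(m, n)) :
  mx_inner A (B - C) = mx_inner A B - mx_inner A C.
Proof. by rewrite mx_innerDr mx_innerNr. Qed.

Lemma mx_innerDl m n (A B C : 'M[R]_(m, n)) :
  mx_inner (A + B) C = mx_inner A C + mx_inner B C.
Proof. by rewrite mx_innerC mx_innerDr !(mx_innerC C). Qed.

Lemma mx_innerZl m n a (A B : 'M[R]_(m, n)) :
  mx_inner (a *: A) B = a * mx_inner A B.
Proof. by rewrite mx_innerC mx_innerZr mx_innerC. Qed.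

Lemma mx_innerNl m n (A B : 'M[R]_(m, n)) : mx_inner (- A) B = - mx_inner A B.
Proof. by rewrite mx_innerC mx_innerNr mx_innerC. Qed.

Lemma mx_innerBl m n (A B C : 'M[R]_(m, n)) :
  mx_inner (A - B) C = mx_inner A C - mx_inner B C.
Proof. by rewrite mx_innerDl mx_innerNl. Qed.

Lemma mx_inner_adjl m n p (M : 'M[R]_(p, m)) (A : 'M_(m, n)) (B : 'M_(p, n)) :
  mx_inner (M *m A) B = mx_inner A (M^T *m B).
Proof. by rewrite /mx_inner trmx_mul mulmxA. Qed.

Lemma mx_inner_adjr m n p (M : 'M[R]_(n, p)) (A : 'M_(m, n)) (B : 'M_(m, p)) :
  mx_inner (A *m M) B = mx_inner A (B *m M^T).
Proof. by rewrite /mx_inner trmx_mul -mulmxA mxtrace_mulC mulmxA. Qed.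

Lemma mx_inner_tr m n (A B : 'M[R]_(m, n)) :
  mx_inner A^T B^T = mx_inner A B.
Proof. by rewrite /mx_inner -trmx_mul mxtrace_tr mxtrace_mulC. Qed.

Lemma col_mulmx m n p (A : 'M[R]_(m, n)) (B : 'M_(n, p)) j :
  col j (A *m B) = A *m col j B.
Proof. by rewrite !colE mulmxA. Qed.

Lemma mx_inner_cols m n (A B : 'M[R]_(m, n)) :
  mx_inner A B = \sum_j mx_inner (col j A) (col j B).
Proof.
rewrite mx_innerE; apply: eq_bigr => j _; rewrite mx_innerE big_ord1.
by apply: eq_bigr => i _; rewrite !mxE.
Qed.

Lemma mx_inner_ge0 m n (A : 'M[R]_(m, n)) : 0 <= mx_inner A A.
Proof.
by rewrite mx_innerE; do 2! (apply: sumr_ge0 => ? _); rewrite -expr2 sqr_ge0.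
Qed.

Lemma mx_inner_eq0 m n (A : 'M[R]_(m, n)) : mx_inner A A = 0 -> A = 0.
Proof.
rewrite mx_innerE => /eqP.
rewrite psumr_eq0 => [/allP A0|j _]; last first.
  by apply: sumr_ge0 => i _; rewrite -expr2 sqr_ge0.
apply/matrixP => i j; rewrite [RHS]mxE; apply/eqP; rewrite -sqrf_eq0.
have := A0 j (mem_index_enum j).
rewrite /= psumr_eq0 => [/allP Aj0|k _]; last by rewrite -expr2 sqr_ge0.
by rewrite expr2; apply: (Aj0 i); rewrite mem_index_enum.
Qed.

Lemma frobenius_norm_sqr m n (A : 'M[R]_(m, n)) :
  frobenius_norm A ^+ 2 = mx_inner A A.
Proof.
have E : mx_inner A A = \sum_i \sum_j A i j ^+ 2.
  by rewrite mx_innerE exchange_big.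
by rewrite /frobenius_norm -E sqr_sqrtr ?mx_inner_ge0.
Qed.

Lemma mx_inner_CauchySchwarz m n (A B : 'M[R]_(m, n)) :
  mx_inner A B ^+ 2 <= mx_inner A A * mx_inner B B.
Proof.
set a := mx_inner A A; set b := mx_inner B B; set c := mx_inner A B.
have [B0|BN0] := eqVneq b 0.
  by rewrite /c (mx_inner_eq0 B0) /mx_inner mulmx0 mxtrace0 expr0n B0 mulr0.
have bgt0 : 0 < b by rewrite lt_def BN0 mx_inner_ge0.
(* c / b minimises the squared norm of A - t B over t. *)
have := mx_inner_ge0 (A - (c / b) *: B).
rewrite mx_innerBl !mx_innerBr !mx_innerZl !mx_innerZr.
rewrite -/a -/b -/c (mx_innerC B A) -/c.
rewrite (_ : _ - _ = (a * b - c ^+ 2) / b); last by field.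
by rewrite pmulr_lge0 ?invr_gt0// subr_ge0.
Qed.

End InnerProduct.

(** * Operator bounds and contractions *)

Section Contractions.
Variable R : realType.

(** The squared form of [|Z x| <= c |x|], which avoids square roots; the case
    [c = 1] is that of contractions. *)
Definition op_bounded m n (c : R) (Z : 'M[R]_(m, n)) :=
  forall x : 'cV_n, mx_inner (Z *m x) (Z *m x) <= c ^+ 2 * mx_inner x x.

Lemma op_bounded_mul m n p c (Z : 'M[R]_(m, n)) (X : 'M_(n, p)) :
  op_bounded c Z -> mx_inner (Z *m X) (Z *m X) <= c ^+ 2 * mx_inner X X.
Proof.
move=> Zc; rewrite mx_inner_cols [in leRHS]mx_inner_cols mulr_sumr.
by apply: ler_sum => j _; rewrite col_mulmx.
Qed.

Lemma op_boundedN m n c (Z : 'M[R]_(m, n)) :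
  op_bounded c Z -> op_bounded c (- Z).
Proof. by move=> Zc x; rewrite mulNmx mx_innerNl mx_innerNr opprK. Qed.

(** With [y = Z^T x], [|y|^2 = <x, Z y> <= |x| |Z y| <= |x| |y|]. *)
Lemma contraction_tr m n (Z : 'M[R]_(m, n)) :
  op_bounded 1 Z -> op_bounded 1 Z^T.
Proof.
move=> Z1 x; set y := Z^T *m x; rewrite expr1n mul1r.
have yE : mx_inner y y = mx_inner x (Z *m y) by rewrite mx_inner_adjl trmxK.
have y_ge0 : 0 <= mx_inner y y by exact: mx_inner_ge0.
have [->|yN0] := eqVneq (mx_inner y y) 0; first exact: mx_inner_ge0.
have ygt0 : 0 < mx_inner y y by rewrite lt_def yN0.
rewrite -(ler_pM2r ygt0) -expr2 {1}yE.
apply: le_trans (mx_inner_CauchySchwarz _ _) _.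
apply: ler_wpM2l; first exact: mx_inner_ge0.
by rewrite -[leRHS]mul1r -[in leRHS](expr1n R 2); exact: Z1.
Qed.

Lemma mx_inner_orthogonal m n (A B : 'M[R]_(m, n)) (V : 'M_n) :
  V^T *m V = 1%:M -> mx_inner A B = mx_inner (A *m V) (B *m V).
Proof. by move=> /mulmx1C VV; rewrite mx_inner_adjr -mulmxA VV mulmx1. Qed.

(** Each column [v_j] of [V] is a unit vector, so [<Z v_j, B v_j>] is at most
    [c s_j]. The [s_j] are only required to dominate the column norms of [B V],
    so that [V] may come from another matrix of which [B] is a truncation. *)
Lemma op_bounded_inner_le m n c (Z B : 'M[R]_(m, n)) (V : 'M_n)
    (s : 'I_n -> R) :
  0 <= c -> op_bounded c Z -> V^T *m V = 1%:M -> (forall j, 0 <= s j) ->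
  (forall j, mx_inner (col j (B *m V)) (col j (B *m V)) <= s j ^+ 2) ->
  mx_inner Z B <= c * \sum_j s j.
Proof.
move=> c0 Zc VV s0 Bs; rewrite (mx_inner_orthogonal _ _ VV).
rewrite mx_inner_cols mulr_sumr.
apply: ler_sum => j _; apply: le_trans (ler_norm _) _.
rewrite -(@ler_pXn2r _ 2) ?nnegrE ?mulr_ge0// -normrX ger0_norm ?sqr_ge0//.
apply: le_trans (mx_inner_CauchySchwarz _ _) _; rewrite exprMn.
apply: ler_pM; rewrite ?mx_inner_ge0//.
rewrite col_mulmx; apply: le_trans (Zc _) _.
have -> : mx_inner (col j V) (col j V) = 1; last by rewrite mulr1.
transitivity ((V^T *m V) j j); last by rewrite VV mxE eqxx.
by rewrite mxE mx_innerE big_ord1; apply: eq_bigr => i _; rewrite !mxE.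
Qed.

End Contractions.

(** * Eigenvalues and right singular vectors *)

Section SingularValues.
Variable R : realType.

(** The characteristic polynomial is invariant under conjugation by [V], so
    its roots with multiplicities are the diagonal entries. *)
Lemma eigenvalues_spectral n (V : 'M[R]_n) (d : 'rV_n) :
  V^T *m V = 1%:M ->
  perm_eq (eigenvalues (V *m diag_mx d *m V^T)) [seq d 0 j | j <- enum 'I_n].
Proof.
move=> VV; have /mulmx1C VVT := VV.
set M := V *m _ *m _.
have charM :
    char_poly M = \prod_(x <- [seq d 0 j | j <- enum 'I_n]) ('X - x%:P).
  rewrite big_map big_enum /=.
  transitivity (char_poly (diag_mx d)); last first.
    rewrite char_poly_trig ?diag_mx_is_trig//.
    by apply: eq_bigr => i _; rewrite mxE eqxx.
  rewrite /char_poly; transitivity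
    (\det (map_mx polyC V *m char_poly_mx (diag_mx d) *m map_mx polyC V^T)).
    congr (\det _); rewrite /char_poly_mx mulmxBr mulmxBl -!map_mxM -/M.
    by rewrite mul_mx_scalar -scalemxAl -map_mxM VVT map_mx1 scalemx1.
  rewrite !det_mulmx mulrAC -det_mulmx -map_mxM VVT map_mx1 det1 mul1r //.
have charN0 : char_poly M != 0 by rewrite monic_neq0 ?char_poly_monic.
apply/allP => x _ /=; rewrite -[X in _ == X]mu_prod_XsubC -charM.
rewrite /eigenvalues count_flatten -map_comp sumnE big_map.
have uniqR : uniq (rootsR (char_poly M)) by exact: uniq_roots.
have rootE := roots_on_rootsR charN0.
under eq_bigr => y _ do rewrite /= count_nseq.
have [xR|xNR] := boolP (x \in rootsR (char_poly M)).
  rewrite (bigD1_seq x) //= eqxx mul1n big1_seq ?addn0// => y /andP[yx _].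
  by rewrite (negbTE yx).
have := rootE x; rewrite in_itv /= (negbTE xNR) => /negbT rN.
rewrite mupNroot// big1_seq// => y /andP[_ yR].
by case: eqP => // yx; rewrite yx (negbTE xNR) in yR.
Qed.

(** A singular value decomposition without left singular vectors: these are
    the normalised nonzero columns of [A V]. The entries of [s] come in no
    particular order, and there are [n] of them, zeros included. *)
Definition singular_basis m n (A : 'M[R]_(m, n)) (V : 'M_n) (s : 'rV[R]_n) :=
  [/\ V^T *m V = 1%:M, forall j, 0 <= s 0 j
    & (A *m V)^T *m (A *m V) = diag_mx (\row_j s 0 j ^+ 2)].

Lemma singular_basis_exists m n (A : 'M[R]_(m, n)) :
  exists V s, singular_basis A V s /\
    perm_eq [seq Num.sqrt x | x <- eigenvalues (A^T *m A)]
            [seq s 0 j | j <- enum 'I_n].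
Proof.
have [|V [d [VV AE]]] := @symmetric_spectral R n (A^T *m A).
  by rewrite trmx_mul trmxK.
have AVE : (A *m V)^T *m (A *m V) = diag_mx d.
  rewrite trmx_mul -mulmxA (mulmxA A^T) AE !mulmxA VV mul1mx -mulmxA VV.
  by rewrite mulmx1.
have d_ge0 j : 0 <= d 0 j.
  have -> : d 0 j = ((A *m V)^T *m (A *m V)) j j by rewrite AVE mxE eqxx.
  by rewrite mxE; apply: sumr_ge0 => i _; rewrite mxE -expr2 sqr_ge0.
exists V, (\row_j Num.sqrt (d 0 j)); split.
  split=> // [j|]; first by rewrite mxE sqrtr_ge0.
  rewrite AVE; congr diag_mx; apply/rowP => j.
  by rewrite !mxE sqr_sqrtr.
rewrite AE.
have -> : [seq (\row_j Num.sqrt (d 0 j)) 0 j | j <- enum 'I_n] =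
          [seq Num.sqrt x | x <- [seq d 0 j | j <- enum 'I_n]].
  by rewrite -[RHS]map_comp; apply: eq_map => j; rewrite /= mxE.
by apply: perm_map; exact: eigenvalues_spectral.
Qed.

(** * Partial isometries spanned by singular vectors *)

(** With [u_j = A v_j / s_j] this is the sum of [u_j v_j^T] over [J]. As
    [0^-1 = 0], an index with [s_j = 0] contributes nothing. *)
Definition basis_isometry m n (A : 'M[R]_(m, n)) (V : 'M_n) (s : 'rV[R]_n)
    (J : {set 'I_n}) : 'M_(m, n) :=
  A *m V *m diag_mx (\row_j ((j \in J)%:R / s 0 j)) *m V^T.

Definition partial_isometry m n (U : 'M[R]_(m, n)) := U *m U^T *m U = U.

Lemma diag_mxM n (d e : 'rV[R]_n) :
  diag_mx d *m diag_mx e = diag_mx (\row_j (d 0 j * e 0 j)).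
Proof. by rewrite mulmx_diag; congr diag_mx; apply/rowP => j; rewrite !mxE. Qed.

Lemma basis_isometryTA m n (A : 'M[R]_(m, n)) V s (J : {set 'I_n}) :
  singular_basis A V s ->
  (basis_isometry A V s J)^T *m (A *m V) =
    V *m diag_mx (\row_j ((j \in J)%:R * s 0 j)).
Proof.
move=> [VV s0 AE]; rewrite /basis_isometry trmx_mul trmxK trmx_mul tr_diag_mx.
rewrite -!mulmxA AE diag_mxM; congr (_ *m diag_mx _).
apply/rowP => j; rewrite !mxE.
by have [->|sN0] := eqVneq (s 0 j) 0; [rewrite expr0n !mulr0 | field].
Qed.

Lemma basis_isometry_source m n (A : 'M[R]_(m, n)) V s (J : {set 'I_n}) :
  singular_basis A V s -> (forall j, j \in J -> s 0 j != 0) ->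
  (basis_isometry A V s J)^T *m basis_isometry A V s J =
    V *m diag_mx (\row_j (j \in J)%:R) *m V^T.
Proof.
move=> sb JN0; rewrite {2}/basis_isometry !mulmxA -(mulmxA _ A V).
rewrite basis_isometryTA// -(mulmxA V) diag_mxM; congr (_ *m diag_mx _ *m _).
apply/rowP => j; rewrite !mxE.
have [jJ|] := boolP (j \in J); last by rewrite !mul0r.
by rewrite mul1r div1r mulfV// JN0.
Qed.

(** [U (U^T U) - U] is [U] times a matrix killed by [U^T U], so its norm
    vanishes. *)
Lemma partial_isometry_source m n (U : 'M[R]_(m, n)) :
  (U^T *m U) *m (U^T *m U) = U^T *m U -> partial_isometry U.
Proof.
move=> QQ; apply/eqP; rewrite -subr_eq0; apply/eqP/mx_inner_eq0.
have -> : U *m U^T *m U - U = U *m (U^T *m U - 1%:M).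
  by rewrite mulmxBr mulmx1 mulmxA.
rewrite mx_inner_adjl mulmxA mulmxBr mulmx1 QQ subrr.
by rewrite /mx_inner mulmx0 mxtrace0.
Qed.

Lemma basis_isometry_partial m n (A : 'M[R]_(m, n)) V s (J : {set 'I_n}) :
  singular_basis A V s -> (forall j, j \in J -> s 0 j != 0) ->
  partial_isometry (basis_isometry A V s J).
Proof.
move=> sb JN0; apply: partial_isometry_source; rewrite basis_isometry_source//.
have [VV _ _] := sb.
rewrite -!mulmxA (mulmxA V^T V) VV mul1mx (mulmxA (diag_mx _)) diag_mxM.
congr (_ *m (diag_mx _ *m _)); apply/rowP => j; rewrite !mxE.
by case: (j \in J); rewrite ?mul1r ?mul0r.
Qed.

Lemma trace_diag n (V : 'M[R]_n) d : V^T *m V = 1%:M ->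
  \tr (V *m diag_mx d *m V^T) = \sum_j d 0 j.
Proof. by move=> VV; rewrite mxtrace_mulC mulmxA VV mul1mx mxtrace_diag. Qed.

Lemma basis_isometry_trace m n (A : 'M[R]_(m, n)) V s (J : {set 'I_n}) :
  singular_basis A V s -> (forall j, j \in J -> s 0 j != 0) ->
  mx_inner (basis_isometry A V s J) (basis_isometry A V s J) = #|J|%:R.
Proof.
move=> sb JN0; rewrite /mx_inner basis_isometry_source//.
rewrite trace_diag; last by case: sb.
under eq_bigr => j _ do rewrite mxE.
by rewrite -natr_sum -big_mkcond sum1_card.
Qed.

(** A diagonal entry of the projection [P = U U^T] is the squared norm of its
    row, hence at least its own square, hence at most [1]; so the trace of [P]
    is at most its size. *)
Lemma partial_isometry_trace_le m n (U : 'M[R]_(m, n)) :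
  partial_isometry U -> mx_inner U U <= m%:R.
Proof.
move=> UU; rewrite /mx_inner mxtrace_mulC.
set P := U *m U^T.
have PP : P *m P^T = P by rewrite /P trmx_mul trmxK mulmxA UU.
clearbody P.
rewrite -[m in m%:R]card_ord -sum1_card natr_sum; apply: ler_sum => i _.
have : P i i ^+ 2 <= P i i.
  rewrite -[leRHS](congr1 (fun M : 'M_m => M i i) PP) mxE (bigD1 i)//=.
  rewrite mxE -expr2 lerDl.
  by apply: sumr_ge0 => j _; rewrite mxE -expr2 sqr_ge0.
nra.
Qed.

(** This is what allows the list of singular values to be cut at
    [minn m n]: the [n] square roots of eigenvalues of [A^T A] contain at most
    [m] nonzero ones. The count is the trace of a projection of size [m]. *)
Lemma card_singular_support m n (A : 'M[R]_(m, n)) V s :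
  singular_basis A V s -> (#|[set j | (s 0 j != 0)%R]| <= m)%N.
Proof.
move=> sb; pose J := [set j | s 0 j != 0].
have JN0 j : j \in J -> s 0 j != 0 by rewrite inE.
rewrite -(ler_nat R) -(basis_isometry_trace sb JN0).
exact: partial_isometry_trace_le (basis_isometry_partial sb JN0).
Qed.

(** * The list of singular values *)

Lemma drop_sorted_count0 (t : seq R) k :
  sorted >=%R t -> all (>= 0) t -> (count (fun x => x != 0%R) t <= k)%N ->
  all (pred1 0) (drop k t).
Proof.
move=> st t0 tk; apply/allP => x xd /=; apply/contraT => xN0.
have xge0 : 0 <= x by apply: (allP t0); apply: mem_drop xd.
have kt : (k < size t)%N.
  by rewrite ltnNge; apply/negP => /drop_oversize dr; rewrite dr in xd.
move: tk; rewrite -{1}(cat_take_drop k t) count_cat.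
have -> : count (fun x => x != 0) (take k t) = k.
  rewrite -[RHS](size_takel (ltnW kt)); apply/eqP; rewrite -all_count.
  apply/allP => y yt; move: st; rewrite -{1}(cat_take_drop k t).
  rewrite sorted_pairwise; last by move=> a b c ab bc; exact: le_trans bc ab.
  rewrite pairwise_cat => /andP[/allrelP /(_ _ _ yt xd) xy _].
  by rewrite gt_eqF// (lt_le_trans _ xy)// lt_def xN0.
rewrite -[leqRHS]addn0 leq_add2l leqn0 eqn0Ngt -has_count.
by move=> /hasPn /(_ x xd); rewrite xN0.
Qed.

Lemma singular_values_basis m n (A : 'M[R]_(m, n)) :
  exists V s, singular_basis A V s /\ exists k,
    perm_eq (singular_values A ++ nseq k 0) [seq s 0 j | j <- enum 'I_n].
Proof.
have [V [s [sb sE]]] := singular_basis_exists A.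
exists V, s; split=> //.
rewrite /singular_values; set l := [seq _ | x <- _] in sE *.
set t := sort _ l.
have tl : perm_eq t l by rewrite perm_sort.
have ts := perm_trans tl sE.
exists (size (drop (minn m n) t)).
suff /all_pred1P <- : all (pred1 0) (drop (minn m n) t).
  by rewrite cat_take_drop.
apply: drop_sorted_count0.
- by apply: sort_sorted => x y; exact: le_total.
- by rewrite (perm_all _ tl); apply/allP => x /mapP[y _ ->]; exact: sqrtr_ge0.
- rewrite (permP ts) count_map leq_min; apply/andP; split.
    apply: leq_trans (card_singular_support sb).
    by rewrite cardsE cardE -size_filter enumT.
  by apply: leq_trans (count_size _ _) _; rewrite size_enum_ord.
Qed.

Lemma size_singular_values m n (A : 'M[R]_(m, n)) :
  size (singular_values A) = minn m n.
Proof.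
have [V [s [_ sE]]] := singular_basis_exists A.
by rewrite size_takel// size_sort (perm_size sE) size_map size_enum_ord
  geq_minr.
Qed.

Lemma sum_sigma m n (A : 'M[R]_(m, n)) (f : R -> R) :
  \sum_(i < minn m n) f (sigma A i) = \sum_(x <- singular_values A) f x.
Proof.
by rewrite (big_nth 0) size_singular_values big_mkord.
Qed.

(** The dropped singular values are zero, so a function vanishing at [0] may be
    summed over the unsorted family [s] instead of the sorted, truncated
    list. *)
Theorem singular_decomposition m n (A : 'M[R]_(m, n)) :
  exists V s, [/\ singular_basis A V s,
    forall f : R -> R, f 0 = 0 ->
      \sum_(i < minn m n) f (sigma A i) = \sum_j f (s 0 j)
    & (0 < minn m n)%N -> forall j, s 0 j <= sigma A 0].
Proof.
have [V [s [sb [k sE]]]] := singular_values_basis A.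
exists V, s; split=> // [f f0|d0 j].
  rewrite sum_sigma -[RHS]big_enum -(big_map (fun j => s 0 j) predT f) /=.
  rewrite -(perm_big _ sE) big_cat /= big_nseq.
  rewrite [X in _ + X](_ : _ = 0) ?addr0//.
  by elim: k {sE} => //= k ->; rewrite f0 addr0.
have srt : sorted >=%R (singular_values A).
  by apply: take_sorted; apply: sort_sorted => x y; exact: le_total.
have sz := size_singular_values A.
have s0 : 0 <= sigma A 0.
  have : sigma A 0 \in [seq s 0 j | j <- enum 'I_n].
    by rewrite -(perm_mem sE) mem_cat mem_nth ?sz.
  by move=> /mapP[i _ ->]; case: sb.
have : s 0 j \in [seq s 0 j | j <- enum 'I_n] by apply: map_f; rewrite mem_enum.
rewrite -(perm_mem sE) mem_cat => /orP[jA|/nseqP[-> _]//].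
move: srt jA; rewrite /sigma; case: (singular_values A) => //= x l xl.
rewrite inE => /orP[/eqP->//|jl].
have := order_path_min _ xl; move/(_ _)/allP; apply => //.
by move=> a b c ab bc; exact: le_trans bc ab.
Qed.

End SingularValues.

(** * Residuals of a partial isometry *)

Section PartialIsometry.
Variable R : realType.

Lemma tr_complement m n (U : 'M[R]_(m, n)) :
  (1%:M - U^T *m U)^T = 1%:M - U^T *m U.
Proof. by rewrite linearB /= trmx1 trmx_mul trmxK. Qed.

Lemma partial_isometry_tr m n (U : 'M[R]_(m, n)) :
  partial_isometry U -> partial_isometry U^T.
Proof.
move=> UU; rewrite /partial_isometry -[RHS](congr1 trmx UU).
by rewrite !trmx_mul !trmxK mulmxA.
Qed.

(** Pythagoras for the orthogonal projection [U^T U], whose image of [X] has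
    the same norm as [U X]. *)
Lemma sqr_norm_complement m n p (U : 'M[R]_(m, n)) (X : 'M_(n, p)) :
  partial_isometry U ->
  mx_inner ((1%:M - U^T *m U) *m X) ((1%:M - U^T *m U) *m X) =
  mx_inner X X - mx_inner (U *m X) (U *m X).
Proof.
move=> UU; rewrite mulmxBl mul1mx -mulmxA; set Y := U *m X.
have XY : mx_inner (U^T *m Y) X = mx_inner Y Y by rewrite mx_inner_adjl trmxK.
have YY : mx_inner (U^T *m Y) (U^T *m Y) = mx_inner Y Y.
  by rewrite mx_inner_adjl trmxK /Y !mulmxA UU.
by rewrite mx_innerBl !mx_innerBr (mx_innerC X) XY YY; ring.
Qed.

Lemma partial_isometry_contraction m n (U : 'M[R]_(m, n)) :
  partial_isometry U -> op_bounded 1 U.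
Proof.
move=> UU x; rewrite expr1n mul1r -subr_ge0 -sqr_norm_complement//.
exact: mx_inner_ge0.
Qed.

(** The component of [X] whose row and column spaces are orthogonal to those of
    [U]. *)
Definition residual m n (U X : 'M[R]_(m, n)) : 'M_(m, n) :=
  (1%:M - U *m U^T) *m X *m (1%:M - U^T *m U).

Lemma residual_adj m n (U X Y : 'M[R]_(m, n)) :
  mx_inner (residual U X) Y = mx_inner X (residual U Y).
Proof.
rewrite /residual mx_inner_adjr mx_inner_adjl tr_complement mulmxA.
by have := tr_complement U^T; rewrite trmxK => ->.
Qed.

Lemma residual_id m n (U X : 'M[R]_(m, n)) :
  partial_isometry U -> residual U (residual U X) = residual U X.
Proof.
move=> UU; have UU' := partial_isometry_tr UU.
have idem p q (V : 'M[R]_(p, q)) : partial_isometry V ->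
    (1%:M - V *m V^T) *m (1%:M - V *m V^T) = 1%:M - V *m V^T.
  move=> VV; rewrite mulmxBr mulmx1 mulmxBl mul1mx !mulmxA VV subrr.
  by rewrite subr0.
rewrite /residual !mulmxA idem// -!mulmxA; congr (_ *m (_ *m _)).
by have := idem _ _ _ UU'; rewrite trmxK.
Qed.

Lemma residual_self m n (U : 'M[R]_(m, n)) :
  partial_isometry U -> residual U U = 0.
Proof. by move=> UU; rewrite /residual mulmxBl mul1mx UU subrr mul0mx. Qed.

(** Taking residuals is an orthogonal projection. With [P = U U^T] and
    [Q = U^T U], what it removes splits orthogonally into [X Q] and
    [P X (1 - Q)], whose norms are those of [X U^T] and [U^T X (1 - Q)]. *)
Lemma residual_sqr_norm m n (U X : 'M[R]_(m, n)) :
  partial_isometry U ->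
  mx_inner (X - residual U X) (X - residual U X) =
    mx_inner (X *m U^T) (X *m U^T)
    + mx_inner (U^T *m (X *m (1%:M - U^T *m U)))
               (U^T *m (X *m (1%:M - U^T *m U))).
Proof.
move=> UU; have UU' := partial_isometry_tr UU.
have -> : mx_inner (X - residual U X) (X - residual U X) =
          mx_inner X X - mx_inner (residual U X) (residual U X).
  have E : mx_inner (residual U X) (residual U X) = mx_inner (residual U X) X.
    by rewrite residual_adj residual_id// mx_innerC.
  by rewrite mx_innerBl !mx_innerBr (mx_innerC X (residual _ _)) E; ring.
rewrite {1 2}/residual -(mulmxA _ X).
have := sqr_norm_complement (X *m (1%:M - U^T *m U)) UU'; rewrite trmxK => ->.
have -> : mx_inner (X *m (1%:M - U^T *m U)) (X *m (1%:M - U^T *m U)) =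
          mx_inner X X - mx_inner (X *m U^T) (X *m U^T).
  rewrite -!(mx_inner_tr (X *m _)) -(mx_inner_tr X X) !trmx_mul trmxK.
  rewrite -sqr_norm_complement//.
  by rewrite tr_complement.
by ring.
Qed.

(** [U] and the residual of [Z] act on orthogonal subspaces and have orthogonal
    ranges, so their sum is a contraction because each of them is. *)
Lemma contraction_add_residual m n (U Z : 'M[R]_(m, n)) :
  partial_isometry U -> op_bounded 1 Z -> op_bounded 1 (U + residual U Z).
Proof.
move=> UU Z1 x; have UU' := partial_isometry_tr UU.
rewrite expr1n mul1r mulmxDl /residual -!mulmxA.
set y := (1%:M - U^T *m U) *m x.
set w := (1%:M - _) *m _.
have Uw : mx_inner (U *m x) w = 0.
  rewrite mx_innerC /w mx_inner_adjl; have := tr_complement U^T.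
  rewrite trmxK => ->; rewrite mulmxA.
  by rewrite mulmxBl mul1mx UU subrr mul0mx /mx_inner mulmx0 mxtrace0.
rewrite mx_innerDl !mx_innerDr (mx_innerC w) Uw addr0 add0r.
have wy : mx_inner w w <= mx_inner y y.
  have := sqr_norm_complement (Z *m y) UU'; rewrite trmxK -/w => ->.
  rewrite lerBlDr; apply: le_trans (Z1 y) _.
  by rewrite expr1n mul1r lerDl mx_inner_ge0.
by have := sqr_norm_complement x UU; rewrite -/y; lra.
Qed.

End PartialIsometry.

(** * Duality and decomposability of the nuclear norm *)

Section NuclearNorm.
Variable R : realType.

Lemma singular_basis_col m n (A : 'M[R]_(m, n)) V s j :
  singular_basis A V s ->
  mx_inner (col j (A *m V)) (col j (A *m V)) = s 0 j ^+ 2.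
Proof.
move=> [_ _ AE]; transitivity (((A *m V)^T *m (A *m V)) j j).
  by rewrite mxE mx_innerE big_ord1; apply: eq_bigr => i _; rewrite !mxE.
by rewrite AE !mxE eqxx.
Qed.

Lemma nuclear_norm_ge_inner m n c (Z A : 'M[R]_(m, n)) :
  0 <= c -> op_bounded c Z -> mx_inner Z A <= c * nuclear_norm A.
Proof.
move=> c0 Zc; have [V [s [sb sE _]]] := singular_decomposition A.
have [VV s0 _] := sb; rewrite /nuclear_norm (sE id)//=.
apply: (op_bounded_inner_le _ _ VV) => // j.
by rewrite (singular_basis_col _ sb).
Qed.

Lemma basis_isometry_inner m n (A : 'M[R]_(m, n)) V s (J : {set 'I_n}) :
  singular_basis A V s ->
  mx_inner (basis_isometry A V s J) A = \sum_(j in J) s 0 j.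
Proof.
move=> sb; have [VV _ _] := sb; have /mulmx1C VVT := VV.
rewrite /mx_inner -[A in X in _ *m X]mulmx1 -VVT (mulmxA A) mulmxA.
rewrite basis_isometryTA// trace_diag// [RHS]big_mkcond /=.
by apply: eq_bigr => j _; rewrite mxE; case: (j \in J); rewrite ?mul1r ?mul0r.
Qed.

(** The maximiser is the polar factor of [A], the sum of [u_j v_j^T] over the
    nonzero singular values. *)
Lemma nuclear_norm_attained m n (A : 'M[R]_(m, n)) :
  exists2 Z, op_bounded 1 Z & mx_inner Z A = nuclear_norm A.
Proof.
have [V [s [sb sE _]]] := singular_decomposition A.
exists (basis_isometry A V s [set j | s 0 j != 0]).
  apply/partial_isometry_contraction/basis_isometry_partial => // j.
  by rewrite inE.
rewrite basis_isometry_inner// /nuclear_norm (sE id)// big_mkcond /=.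
by apply: eq_bigr => j _; rewrite inE; case: eqVneq.
Qed.

(** A singular basis is not unique, but duality bounds the nuclear norm from
    both sides by the sum attached to any of them. *)
Lemma nuclear_norm_singular_basis m n (A : 'M[R]_(m, n)) V s :
  singular_basis A V s -> nuclear_norm A = \sum_j s 0 j.
Proof.
move=> sb; have [VV s0 _] := sb; apply/eqP; rewrite eq_le; apply/andP; split.
  have [Z Z1 <-] := nuclear_norm_attained A.
  rewrite -[leRHS]mul1r; apply: (op_bounded_inner_le _ _ VV) => // j.
  by rewrite (singular_basis_col _ sb).
pose J := [set j | s 0 j != 0].
have UU : partial_isometry (basis_isometry A V s J).
  by apply: basis_isometry_partial => // j; rewrite inE.
have := nuclear_norm_ge_inner A ler01 (partial_isometry_contraction UU).
rewrite mul1r basis_isometry_inner// big_mkcond; apply: le_trans.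
by apply: ler_sum => j _; rewrite inE; case: eqVneq => [->|].
Qed.

Lemma nuclear_normD m n (A B : 'M[R]_(m, n)) :
  nuclear_norm (A + B) <= nuclear_norm A + nuclear_norm B.
Proof.
have [Z Z1 <-] := nuclear_norm_attained (A + B).
rewrite mx_innerDr -(mul1r (nuclear_norm A)) -(mul1r (nuclear_norm B)).
by rewrite lerD// nuclear_norm_ge_inner.
Qed.

Lemma nuclear_norm_ge0 m n (A : 'M[R]_(m, n)) : 0 <= nuclear_norm A.
Proof.
have [V [s [[_ s0 _] sE _]]] := singular_decomposition A.
by rewrite /nuclear_norm (sE id)// sumr_ge0.
Qed.

Lemma op_bounded_op_norm m n (A : 'M[R]_(m, n)) :
  (0 < minn m n)%N -> op_bounded (op_norm A) A.
Proof.
move=> mn0 x.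
have [V [s [[VV s0 AE] _ /(_ mn0) sle]]] := singular_decomposition A.
have /mulmx1C VVT := VV.
set y := V^T *m x.
have xE : x = V *m y by rewrite /y mulmxA VVT mul1mx.
have -> : mx_inner x x = mx_inner y y.
  by rewrite xE mx_inner_adjl mulmxA VV mul1mx.
rewrite xE mulmxA mx_inner_adjl mulmxA AE mul_diag_mx !mx_innerE !big_ord1.
rewrite mulr_sumr; apply: ler_sum => i _; rewrite !mxE mulrCA ler_wpM2r//.
  by rewrite -expr2 sqr_ge0.
by rewrite ler_pXn2r ?nnegrE ?sle// (le_trans _ (sle i)).
Qed.

Lemma mx_inner_le_op_nuclear m n (W A : 'M[R]_(m, n)) :
  (0 < minn m n)%N -> mx_inner W A <= op_norm W * nuclear_norm A.
Proof.
move=> mn0; apply: (nuclear_norm_ge_inner _ _ (op_bounded_op_norm W mn0)).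
have [V [s [[_ s0 _] _ /(_ mn0) sle]]] := singular_decomposition W.
move: mn0; rewrite leq_min => /andP[_ n0].
exact: le_trans (s0 (Ordinal n0)) (sle _).
Qed.

(** The nonresidual part has rank at most [2 r], where [r = <U, U>]. Rank does
    not appear in the proof: if the contraction [W] attains the nuclear norm of
    [X - residual U X], self-adjointness moves the projection onto [W], and
    the squared Frobenius norm of [W - residual U W] splits into two terms of
    size at most [r]. *)
Lemma nuclear_norm_nonresidual m n (U X : 'M[R]_(m, n)) :
  partial_isometry U ->
  nuclear_norm (X - residual U X) ^+ 2
    <= 2 * mx_inner U U * frobenius_norm X ^+ 2.
Proof.
move=> UU; have [W W1 <-] := nuclear_norm_attained (X - residual U X).
rewrite mx_innerBr -residual_adj -mx_innerBl frobenius_norm_sqr.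
apply: le_trans (mx_inner_CauchySchwarz _ _) _.
apply: ler_wpM2r; first exact: mx_inner_ge0.
rewrite residual_sqr_norm// mulr_natl mulr2n; apply: lerD.
  have := op_bounded_mul U^T W1.
  by rewrite expr1n mul1r mx_inner_tr.
have -> : U^T *m (W *m (1%:M - U^T *m U)) =
          ((1%:M - U^T *m U) *m (W^T *m U))^T.
  by rewrite !trmx_mul tr_complement !trmxK !mulmxA.
rewrite mx_inner_tr sqr_norm_complement// lerBlDr.
have := op_bounded_mul U (contraction_tr W1); rewrite expr1n mul1r => h.
by apply: le_trans h _; rewrite lerDl mx_inner_ge0.
Qed.

(** The residual of [A] itself keeps only the singular pairs outside [J]. *)
Lemma residual_inner_ge m n (A Z : 'M[R]_(m, n)) V s (J : {set 'I_n}) :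
  singular_basis A V s -> (forall j, j \in J -> s 0 j != 0) ->
  op_bounded 1 Z ->
  - (\sum_(j | j \notin J) s 0 j) <=
    mx_inner (residual (basis_isometry A V s J) Z) A.
Proof.
move=> sb JN0 Z1; set U := basis_isometry A V s J.
have UU : partial_isometry U by exact: basis_isometry_partial.
have UU' := partial_isometry_tr UU.
have [VV s0 _] := sb.
rewrite residual_adj lerNl -mx_innerNl.
have NZ1 := op_boundedN Z1.
have -> : \sum_(j | j \notin J) s 0 j = 1 * \sum_j (j \notin J)%:R * s 0 j.
  rewrite mul1r big_mkcond /=; apply: eq_bigr => j _.
  by case: (j \in J); rewrite ?mul1r ?mul0r.
apply: (op_bounded_inner_le _ _ VV) => // j; first by rewrite mulr_ge0.
have -> : residual U A *m V =
    (1%:M - U *m U^T) *m (A *m V *m diag_mx (\row_j (j \notin J)%:R)).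
  rewrite /residual -!mulmxA; congr (_ *m (_ *m _)).
  rewrite basis_isometry_source// mulmxBl mul1mx -(mulmxA _ V^T) VV mulmx1.
  rewrite -[X in X - _]mulmx1 -mulmxBr; congr (_ *m _).
  apply/matrixP => i k; rewrite !mxE; have [->|_] := eqVneq i k.
    by case: (k \in J); rewrite ?subrr ?subr0.
  by rewrite subrr.
rewrite col_mulmx.
set y := col j _.
have := sqr_norm_complement y UU'; rewrite trmxK => ->.
rewrite lerBlDr; have -> : y = (j \notin J)%:R *: col j (A *m V).
  rewrite /y mul_mx_diag; apply/colP => i; rewrite !mxE mulrC.
  by congr (_ * _); rewrite mxE.
rewrite mx_innerZl mx_innerZr (singular_basis_col _ sb) mulrA -expr2 -exprMn.
by rewrite lerDl mx_inner_ge0.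
Qed.

(** Test [A + D] with the contraction [U + residual U Z], where [Z] attains the
    nuclear norm of the residual of [D]: it sees the singular values of [A]
    indexed by [J] and the residual of [D] in full, and loses at most the other
    singular values and the nonresidual part of [D]. *)
Lemma nuclear_norm_decomposable m n (A D : 'M[R]_(m, n)) V s (J : {set 'I_n})
    (U := basis_isometry A V s J) :
  singular_basis A V s -> (forall j, j \in J -> s 0 j != 0) ->
  nuclear_norm A - 2 * (\sum_(j | j \notin J) s 0 j)
    - nuclear_norm (D - residual U D) + nuclear_norm (residual U D)
  <= nuclear_norm (A + D).
Proof.
move=> sb JN0.
have UU : partial_isometry U by exact: basis_isometry_partial.
have [Z Z1 ZE] := nuclear_norm_attained (residual U D).
have W1 := contraction_add_residual UU Z1; set W := U + _ in W1.
have := nuclear_norm_ge_inner (A + D) ler01 W1; rewrite mul1r.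
apply: le_trans.
have NA : nuclear_norm A = \sum_(j in J) s 0 j + \sum_(j | j \notin J) s 0 j.
  by rewrite (nuclear_norm_singular_basis sb) (bigID (mem J)).
have WA : \sum_(j in J) s 0 j - \sum_(j | j \notin J) s 0 j <= mx_inner W A.
  by rewrite /W mx_innerDl basis_isometry_inner// lerD2l residual_inner_ge.
have WD : - nuclear_norm (D - residual U D) <= mx_inner W (D - residual U D).
  rewrite lerNl -mx_innerNl -[leRHS]mul1r.
  exact: nuclear_norm_ge_inner (op_boundedN W1).
have WR : mx_inner W (residual U D) = nuclear_norm (residual U D).
  rewrite /W mx_innerDl -residual_adj residual_self// residual_adj.
  by rewrite residual_id// ZE /mx_inner trmx0 mul0mx mxtrace0 add0r.
rewrite mx_innerDr -[D in mx_inner W D](subrK (residual U D)) mx_innerDr WR NA.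
lra.
Qed.

End NuclearNorm.

Lemma nuclear_normN (R : realType) m n (A : 'M[R]_(m, n)) :
  nuclear_norm (- A) = nuclear_norm A.
Proof.
have le B : nuclear_norm (- B : 'M[R]_(m, n)) <= nuclear_norm B.
  have [Z Z1 <-] := nuclear_norm_attained (- B).
  rewrite mx_innerNr -mx_innerNl -[leRHS]mul1r.
  exact: nuclear_norm_ge_inner (op_boundedN Z1).
by apply/eqP; rewrite eq_le le -{1}[A]opprK le.
Qed.

(** * Thresholding and scalar estimates *)

Section Scalars.
Variable R : realType.

(** Entries above [rho] have [s^q >= rho^q], which bounds their number; those
    below satisfy [s = s^q s^(1 - q) <= s^q rho^(1 - q)]. The convention for
    the zero power at [0] makes this hold for [q = 0] too. *)
Lemma lq_threshold (I : finType) (s : I -> R) (rho q Rq : R)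
    (J := [set j | rho < s j]) :
  0 < rho -> 0 <= q -> q <= 1 -> (forall j, 0 <= s j) ->
  \sum_j powR00 (s j) q <= Rq ->
  #|J|%:R * rho `^ q <= Rq /\ \sum_(j | j \notin J) s j <= Rq * rho `^ (1 - q).
Proof.
move=> rho0 q0 q1 s0 sRq.
have pow_ge0 j : 0 <= powR00 (s j) q.
  by rewrite /powR00; case: ifP => // _; exact: powR_ge0.
split.
  apply: le_trans sRq; rewrite mulr_natl -sumr_const.
  rewrite [leRHS](bigID (mem J)) /= -[leLHS]addr0 lerD ?sumr_ge0//.
  apply: ler_sum => j; rewrite inE => rs.
  have sj0 : 0 < s j by exact: lt_trans rs.
  by rewrite /powR00 gt_eqF// ge0_ler_powR ?nnegrE// ltW.
apply: (@le_trans _ _ (\sum_(j | j \notin J) powR00 (s j) q * rho `^ (1 - q))).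
  apply: ler_sum => j; rewrite inE -leNgt => sr.
  rewrite /powR00; case: eqVneq => [->|sN0]; first by rewrite mul0r.
  have sj0 : 0 < s j by rewrite lt_def sN0 s0.
  have {1}-> : s j = s j `^ q * s j `^ (1 - q).
    by rewrite -powRD ?sN0 ?implybT// addrC subrK powRr1// ltW.
  rewrite ler_wpM2l ?powR_ge0// ge0_ler_powR ?nnegrE ?subr_ge0// ltW//.
rewrite -mulr_suml ler_wpM2r ?powR_ge0//; apply: le_trans sRq.
by rewrite [leRHS](bigID (mem J)) /= lerDr sumr_ge0.
Qed.

(** The hypothesis on [aF] and [N <= 2 omega] alone would give only
    [b - a <= N]. If [N <= (6/5) omega], the term [tau N^2] is at most
    [(3/5) lambda N]. Otherwise [b - a <= 2 omega - N], because [N <= a + b] and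
    [b <= omega], and this is at most [(2/3) N]. *)
Lemma norm_gap_bound (N omega c lambda tau a b aF : R) :
  0 < omega -> 0 < lambda -> 0 <= N -> 0 <= aF -> 0 <= tau ->
  tau * omega <= c -> 2 * c <= lambda ->
  a <= omega -> b <= omega -> N <= a + b ->
  aF <= tau * N ^+ 2 + 2 * c * N + 2 * lambda * (a - b) ->
  5 * (b - a) <= 4 * N.
Proof.
move=> w0 l0 N0 aF0 tau0 tauw cl aw bw Nab basic.
have h1 : 4 * (omega * (b - a)) <= N * (N + 2 * omega).
  rewrite -(ler_pM2l l0).
  have e1 : tau * omega * N ^+ 2 <= c * N ^+ 2 by rewrite ler_wpM2r ?sqr_ge0.
  have e2 : 2 * c * (N * (N + 2 * omega)) <= lambda * (N * (N + 2 * omega)).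
    by rewrite ler_wpM2r// mulr_ge0//; lra.
  have e3 : 0 <= omega * (tau * N ^+ 2 + 2 * c * N + 2 * lambda * (a - b)).
    by rewrite mulr_ge0//; lra.
  nra.
(* 6/5 is the largest multiple of omega for which bounding one factor of N^2
   still leads to the ratio 4/5. *)
have [N65|N65] := leP (5 * N) (6 * omega).
  rewrite -(ler_pM2l w0).
  have : N * (5 * N) <= N * (6 * omega) by rewrite ler_wpM2l.
  nra.
lra.
Qed.

(** As [N <= 2 omega] and [2 c <= lambda], [tau N^2] and [2 c N] are each at most
    [lambda N]; then [N <= N' + N''] cancels the [- N''] supplied by
    decomposability. *)
Lemma frobenius_linear_bound (F2 N N' N'' omega c lambda tau a b t alpha : R) :
  0 < lambda -> 0 < alpha -> 0 <= N -> 0 <= tau ->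
  tau * omega <= c -> 2 * c <= lambda -> a <= omega -> b <= omega ->
  N <= a + b -> N <= N' + N'' -> a - 2 * t - N' + N'' <= b ->
  alpha * F2 <= tau * N ^+ 2 + 2 * c * N + 2 * lambda * (a - b) ->
  F2 <= 4 * (lambda / alpha) * (N' + t).
Proof.
move=> l0 al0 N0 tau0 tauw cl aw bw Nab tri dec basic.
rewrite -(ler_pM2l al0).
have -> : alpha * (4 * (lambda / alpha) * (N' + t)) = 4 * lambda * (N' + t).
  by field; rewrite gt_eqF.
have e1 : tau * N ^+ 2 <= tau * (2 * omega) * N.
  by rewrite -mulrA ler_wpM2l// expr2 ler_wpM2r//; lra.
have e2 : tau * (2 * omega) * N <= lambda * N by rewrite ler_wpM2r//; lra.
have e3 : 2 * c * N <= lambda * N by rewrite ler_wpM2r.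
have e4 := ler_wpM2l (ltW l0) dec.
have e5 := ler_wpM2l (ltW l0) tri.
lra.
Qed.

(** [4 rho N'] is split by the arithmetic-geometric mean inequality so that half
    of [F^2] is absorbed on the left. The variables [g] and [h] stand for
    [rho^q] and [rho^(1 - q)]. *)
Lemma frobenius_quadratic_bound (F N' t r rho g h Rq : R) :
  0 < rho -> 0 < g -> 0 < h -> rho = g * h ->
  F ^+ 2 <= 4 * rho * (N' + t) -> N' ^+ 2 <= 2 * r * F ^+ 2 ->
  0 <= r -> r * g <= Rq -> t <= Rq * h ->
  F ^+ 2 <= 40 * Rq * (rho * h).
Proof.
move=> rho0 g0 h0 rhoE FN NF r0 rg tR.
have e1 : rho * t <= Rq * (rho * h).
  by rewrite (mulrCA Rq) ler_wpM2l// ltW.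
have e2 : rho ^+ 2 * r <= Rq * (rho * h).
  rewrite expr2 {1}rhoE (_ : _ * r = (r * g) * (rho * h)); last by ring.
  by rewrite ler_wpM2r// mulr_ge0 ?ltW.
have e3 : 4 * rho * N' <= F ^+ 2 / 2 + 16 * (rho ^+ 2 * r).
  have FR0 : 0 <= F ^+ 2 / 2 + 16 * (rho ^+ 2 * r).
    by rewrite addr_ge0 ?divr_ge0 ?sqr_ge0// mulr_ge0// mulr_ge0 ?sqr_ge0.
  apply: le_trans (ler_norm _) _; rewrite -(@ler_pXn2r _ 2) ?nnegrE//.
  rewrite -normrX ger0_norm ?sqr_ge0//.
  apply: (@le_trans _ _ (32 * (rho ^+ 2 * r) * F ^+ 2)); last first.
    rewrite -subr_ge0 (_ : _ - _ = (F ^+ 2 / 2 - 16 * (rho ^+ 2 * r)) ^+ 2).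
      exact: sqr_ge0.
    by field.
  have -> : (4 * rho * N') ^+ 2 = 16 * rho ^+ 2 * N' ^+ 2 by ring.
  have -> : 32 * (rho ^+ 2 * r) * F ^+ 2 = 16 * rho ^+ 2 * (2 * r * F ^+ 2).
    by ring.
  by rewrite ler_wpM2l// mulr_ge0 ?sqr_ge0.
lra.
Qed.

(** The gap bound and decomposability give [N'' <= 9 N' + 10 t], hence
    [N <= 10 (N' + t)], while [N' <= sqrt 80 Rq h <= 9 Rq h]. The total,
    [100 Rq h], is below the stated constant because [sqrt 17 >= 4]. *)
Lemma nuclear_cone_bound (N N' N'' F a b t r g h Rq : R) :
  0 <= N' -> 0 <= N -> 0 < g -> 0 < h -> 0 <= r -> 0 <= Rq ->
  5 * (b - a) <= 4 * N -> N <= N' + N'' -> a - 2 * t - N' + N'' <= b ->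
  N' ^+ 2 <= 2 * r * F ^+ 2 -> F ^+ 2 <= 40 * Rq * (g * h * h) ->
  r * g <= Rq -> t <= Rq * h ->
  N <= (4 + 32 * Num.sqrt 17) * Rq * h.
Proof.
move=> N'0 N0 g0 h0 r0 Rq0 cone tri dec NF FR rg tR.
have N'h : N' <= 9 * (Rq * h).
  rewrite -(@ler_pXn2r _ 2) ?nnegrE ?mulr_ge0 ?(ltW h0)//.
  apply: le_trans NF _.
  apply: (@le_trans _ _ (2 * r * (40 * Rq * (g * h * h)))).
    by rewrite ler_wpM2l// mulr_ge0.
  rewrite (_ : 2 * r * _ = 80 * ((r * g) * (Rq * h ^+ 2))); last by ring.
  apply: (@le_trans _ _ (80 * (Rq * (Rq * h ^+ 2)))).
    by rewrite ler_wpM2l// ler_wpM2r// mulr_ge0 ?sqr_ge0.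
  have : 0 <= Rq * (Rq * h ^+ 2) by rewrite mulr_ge0// mulr_ge0 ?sqr_ge0.
  nra.
have s17 : 4 <= Num.sqrt (17 : R).
  have -> : (4 : R) = Num.sqrt (4 ^+ 2) by rewrite sqrtr_sqr ger0_norm.
  by rewrite ler_sqrt// -natrX ler_nat.
have Rh : 0 <= Rq * h by rewrite mulr_ge0// ltW.
have : 132 * (Rq * h) <= (4 + 32 * Num.sqrt 17) * (Rq * h).
  by rewrite ler_wpM2r//; lra.
lra.
Qed.

End Scalars.

(** Expand the quadratic around [X]: the cross terms merge because [Gamma] is
    symmetric. *)
Lemma objective_basic_inequality (R : realType) m n (Gamma : 'M[R]_m)
    (Upsilon X Y : 'M[R]_(m, n)) lambda :
  Gamma^T = Gamma ->
  objective Gamma Upsilon lambda Y <= objective Gamma Upsilon lambda X ->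
  mx_inner (Gamma *m (Y - X)) (Y - X) <=
    2 * mx_inner (Upsilon - Gamma *m X) (Y - X)
    + 2 * lambda * (nuclear_norm X - nuclear_norm Y).
Proof.
move=> Gsym; rewrite /objective.
have [D ->] : exists D, Y = X + D by exists (Y - X); rewrite addrC subrK.
have -> : X + D - X = D by rewrite addrAC subrr add0r.
rewrite mulmxDr.
rewrite !mx_innerDl !mx_innerDr mx_innerNl.
have -> : mx_inner (Gamma *m D) X = mx_inner (Gamma *m X) D.
  by rewrite mx_inner_adjl Gsym mx_innerC.
lra.
Qed.

(** * The error bounds *)

Local Open Scope classical_set_scope.
Local Open Scope ring_scope.

Theorem theorem1 (R : realType) (d1 d2 n : nat)
  (d1_gt0 : (0 < d1)%N) (d2_gt0 : (0 < d2)%N) (n_gt0 : (0 < n)%N)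
  (Thetastar Thetahat Upsilon : 'M[R]_(d1, d2)) (Gamma : 'M[R]_d1)
  (q Rq omega phi lambda alpha1 tau : R)
  (Gamma_sym : Gamma^T = Gamma)
  (q_ge0 : 0 <= q) (q_le1 : q <= 1)
  (Rq_gt0 : 0 < Rq) (omega_gt0 : 0 < omega)
  (phi_gt0 : 0 < phi) (lambda_gt0 : 0 < lambda)
  (alpha1_gt0 : 0 < alpha1) (tau_gt0 : 0 < tau)
  (Thetastar_in :
     (@lq_ball R d1 d2 q Rq `&` @nuclear_ball R d1 d2 omega) Thetastar)
  (Thetahat_opt :
     global_minimizer (@nuclear_ball R d1 d2 omega)
       (objective Gamma Upsilon lambda) Thetahat)
  (deviation : op_norm (Upsilon - Gamma *m Thetastar)
     <= phi * Num.sqrt ((maxn d1 d2)%:R / n%:R))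
  (RSC : forall Delta : 'M[R]_(d1, d2),
     alpha1 * frobenius_norm Delta ^+ 2 - tau * nuclear_norm Delta ^+ 2
       <= mx_inner (Gamma *m Delta) Delta)
  (tau_le : tau <= phi / omega * Num.sqrt ((maxn d1 d2)%:R / n%:R))
  (lambda_ge : 2 * phi * Num.sqrt ((maxn d1 d2)%:R / n%:R) <= lambda) :
  frobenius_norm (Thetahat - Thetastar) ^+ 2
    <= 544 * Rq * (lambda / alpha1) `^ (2 - q)
  /\
  nuclear_norm (Thetahat - Thetastar)
    <= (4 + 32 * Num.sqrt 17) * Rq * (lambda / alpha1) `^ (1 - q).
Proof.
set c := phi * Num.sqrt ((maxn d1 d2)%:R / n%:R) in deviation *.
have mn0 : (0 < minn d1 d2)%N by rewrite leq_min d1_gt0.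
have [Tball [Sb Hopt]] : lq_ball q Rq Thetastar /\ global_minimizer
  (@nuclear_ball R d1 d2 omega) (objective Gamma Upsilon lambda) Thetahat.
  by case: Thetastar_in.
have Ts : nuclear_norm Thetastar <= omega by case: Thetastar_in.
have Th : nuclear_norm Thetahat <= omega by [].
have [V [s [sb sE _]]] := singular_decomposition Thetastar.
have [VV s0 _] := sb.
pose rho := lambda / alpha1; have rho0 : 0 < rho by exact: divr_gt0.
pose J := [set j | rho < s 0 j]%SET; pose U := basis_isometry Thetastar V s J.
have JN0 j : j \in J -> s 0 j != 0.
  by rewrite inE => /(lt_trans rho0); rewrite lt_neqAle eq_sym => /andP[].
have UU : partial_isometry U by exact: basis_isometry_partial.
set t := \sum_(j | j \notin J) s 0 j.
have [rJ tJ] : #|J|%:R * rho `^ q <= Rq /\ t <= Rq * rho `^ (1 - q).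
  apply: lq_threshold => //; move: Tball; rewrite /lq_ball /=.
  rewrite (sE (fun x => powR00 `|x| q)); last by rewrite normr0 /powR00 eqxx.
  by apply: le_trans; apply: ler_sum => j _; rewrite ger0_norm.
have := basis_isometry_trace sb JN0; rewrite -/U => trU.
set D := Thetahat - Thetastar.
have NF := nuclear_norm_nonresidual D UU; rewrite trU in NF.
have dec := nuclear_norm_decomposable D sb JN0; rewrite -/U -/t in dec.
rewrite (_ : Thetastar + D = Thetahat) in dec; last by rewrite addrC subrK.
have tri : nuclear_norm D <=
    nuclear_norm (D - residual U D) + nuclear_norm (residual U D).
  by rewrite -{1}(subrK (residual U D) D) nuclear_normD.
have tri' : nuclear_norm D <= nuclear_norm Thetastar + nuclear_norm Thetahat.
  by rewrite addrC -(nuclear_normN Thetastar) nuclear_normD.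
have basic := objective_basic_inequality Gamma_sym (Hopt _ Ts).
rewrite -/D in basic.
have dev : mx_inner (Upsilon - Gamma *m Thetastar) D <= c * nuclear_norm D.
  apply: le_trans (mx_inner_le_op_nuclear _ _ mn0) _.
  by rewrite ler_wpM2r ?nuclear_norm_ge0.
have RSCD := RSC D.
have N0 := nuclear_norm_ge0 D.
have N'0 := nuclear_norm_ge0 (D - residual U D).
have cl : 2 * c <= lambda by rewrite /c mulrA.
have tauw : tau * omega <= c.
  rewrite -ler_pdivlMr//; apply: le_trans tau_le _.
  by rewrite /c mulrAC.
have aF0 : 0 <= alpha1 * frobenius_norm D ^+ 2.
  by rewrite mulr_ge0 ?sqr_ge0// ltW.
have basicF : alpha1 * frobenius_norm D ^+ 2 <= tau * nuclear_norm D ^+ 2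
    + 2 * c * nuclear_norm D
    + 2 * lambda * (nuclear_norm Thetastar - nuclear_norm Thetahat).
  move: RSCD; rewrite lerBlDl => /le_trans; apply; rewrite -addrA lerD2l.
  apply: le_trans basic _; rewrite lerD2r -mulrA.
  by rewrite ler_wpM2l.
have cone := norm_gap_bound omega_gt0 lambda_gt0 N0 aF0 (ltW tau_gt0) tauw cl
  Ts Th tri' basicF.
have F1 : frobenius_norm D ^+ 2 <=
    4 * rho * (nuclear_norm (D - residual U D) + t).
  exact: (frobenius_linear_bound lambda_gt0 alpha1_gt0 N0 (ltW tau_gt0) tauw cl
    Ts Th tri' tri dec basicF).
have g0 : 0 < rho `^ q by exact: powR_gt0.
have h0 : 0 < rho `^ (1 - q) by exact: powR_gt0.
have rhoD x y : rho `^ (x + y) = rho `^ x * rho `^ y.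
  by rewrite powRD// (gt_eqF rho0) implybT.
have rho1 : rho `^ 1 = rho by rewrite powRr1// ltW.
have rhoE : rho = rho `^ q * rho `^ (1 - q).
  by rewrite -rhoD addrC subrK rho1.
have rhoh : rho `^ (2 - q) = rho * rho `^ (1 - q).
  have -> : 2 - q = 1 + (1 - q) by rewrite addrA.
  by rewrite rhoD rho1.
have r0 : (0 : R) <= #|J|%:R by [].
have F2 := frobenius_quadratic_bound rho0 g0 h0 rhoE F1 NF r0 rJ tJ.
split.
  rewrite -/rho rhoh; apply: le_trans F2 _.
  apply: ler_wpM2r; first by rewrite mulr_ge0// ltW.
  by apply: ler_wpM2r; [exact: ltW | rewrite ler_nat].
rewrite {1}rhoE in F2.
exact: (nuclear_cone_bound N'0 N0 g0 h0 r0 (ltW Rq_gt0) cone tri dec NF F2 rJ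
  tJ).
Qed.
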